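(* Let $\alpha>0$ be a constant. The function $$p^\alpha_{\mathbb{R}^+}(x,y)=\frac{|x-y|}{\sqrt{(x-y)^2+\alpha xy}},\quad x,y>0,$$ is a metric on $\mathbb{R}^+$ if and only if $\alpha\le12$.
   Context: $\mathbb{R}^+=(0,\infty)$ is the positive real axis. *)

(* Defs.v *)
From Stdlib Require Import Reals.

Open Scope R_scope.

(* The axioms of [Rlimit.Metric_Space], relativized to the points of [D]:
   the values of [d] outside [D] are irrelevant. *)
Definition is_metric_on {X : Type} (D : X -> Prop) (d : X -> X -> R) : Prop :=
  (forall x y, D x -> D y -> 0 <= d x y) /\
  (forall x y, D x -> D y -> (d x y = 0 <-> x = y)) /\
  (forall x y, D x -> D y -> d x y = d y x) /\
  (forall x y z, D x -> D y -> D z -> d x y <= d x z + d z y).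

Definition Rpos (x : R) : Prop := 0 < x.

(* For [alpha, x, y > 0] the radicand is positive, so neither the convention
   [sqrt r = 0] for [r < 0] nor division by zero intervenes on [Rpos]. *)
Definition p_alpha (alpha x y : R) : R :=
  Rabs (x - y) / sqrt ((x - y) ^ 2 + alpha * x * y).

(* Main.v *)
(** In the variable [r = y / x] the function is [ratio r = (r - 1) / sqrt D(r)],
    [D(r) = (r - 1)^2 + alpha r], and for [x <= z <= y] the triangle inequality
    says [ratio (r s) <= ratio r + ratio s]. Differentiating in [r], this follows
    once [r ratio'(r)] decreases on [r >= 1]. Up to a constant its square is
    [X / (X + k)^3] with [X = (r + 1)^2 / r >= 4] and [k = alpha - 4], which
    decreases because [X Y (X + Y + 3 k) - k^3 >= (8 - k) (k + 4)^2 >= 0] for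
    [X, Y >= 4] and [-4 <= k <= 8]. Conversely, if [alpha > 12]
    the triangle inequality fails on [1, r, r^2] as soon as
    [r > 1] and [4 < X < alpha / 3]. *)
Require Import Defs.
From Stdlib Require Import Reals.
From Stdlib Require Import Lra.
From Coquelicot Require Import Coquelicot.

Open Scope R_scope.

Lemma nondecreasing_of_derivative_nonneg (f f' : R -> R) (a b : R) :
  a <= b ->
  (forall c, a <= c <= b -> derivable_pt_lim f c (f' c)) ->
  (forall c, a <= c <= b -> 0 <= f' c) ->
  f a <= f b.
Proof.
  intros [Hab | ->] Hd Hpos; [|lra].
  destruct (MVT_cor2 f f' a b Hab Hd) as [c [Hc Hin]].
  assert (0 <= f' c) by (apply Hpos; lra).
  nra.
Qed.

(** * The one-variable profile and its derivative *)

Definition radicand (alpha r : R) : R := (r - 1) ^ 2 + alpha * r.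

Definition ratio (alpha r : R) : R := (r - 1) / sqrt (radicand alpha r).

Definition ratio' (alpha r : R) : R :=
  alpha * (r + 1) / (2 * (radicand alpha r * sqrt (radicand alpha r))).

Lemma radicand_pos alpha r : 0 < alpha -> 0 < r -> 0 < radicand alpha r.
Proof.
  intros Ha Hr. unfold radicand.
  assert (H1 := pow2_ge_0 (r - 1)).
  assert (H2 := Rmult_lt_0_compat _ _ Ha Hr).
  lra.
Qed.

Lemma ratio_derivative alpha r :
  0 < alpha -> 0 < r -> derivable_pt_lim (ratio alpha) r (ratio' alpha r).
Proof.
  intros Ha Hr.
  assert (HD := radicand_pos alpha r Ha Hr).
  assert (HS := sqrt_lt_R0 _ HD).
  assert (HSS := sqrt_sqrt _ (Rlt_le _ _ HD)).
  apply is_derive_Reals.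
  unfold ratio, ratio'; unfold radicand in *.
  (* The form in which [auto_derive] leaves the radicand. *)
  replace ((r - 1) ^ 2) with ((r + - (1)) * ((r + - (1)) * 1)) in * by ring.
  auto_derive.
  { repeat split; [exact HD | apply Rgt_not_eq; exact HS]. }
  set (S := sqrt _) in *.
  set (D := (r + - (1)) * ((r + - (1)) * 1) + alpha * r) in *.
  (* The quotient rule leaves the numerator [2 D - (r - 1) D'], in which the quadratic terms
     cancel. *)
  assert (Hlin : alpha * (r + 1) = 2 * D - (r - 1) * (2 * (r - 1) + alpha))
    by (unfold D; ring).
  rewrite Hlin, <- HSS. field. lra.
Qed.

Lemma ratio'_nonneg alpha r : 0 < alpha -> 0 < r -> 0 <= ratio' alpha r.
Proof.
  intros Ha Hr.
  assert (HD := radicand_pos alpha r Ha Hr).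
  assert (HS := sqrt_lt_R0 _ HD).
  apply Rdiv_le_0_compat; nra.
Qed.

Lemma ratio_nondecreasing alpha r t :
  0 < alpha -> 1 <= r <= t -> ratio alpha r <= ratio alpha t.
Proof.
  intros Ha Hrt.
  apply nondecreasing_of_derivative_nonneg with (f' := ratio' alpha); [lra| |].
  - intros; apply ratio_derivative; lra.
  - intros; apply ratio'_nonneg; lra.
Qed.

(** * Subadditivity under multiplication for [alpha <= 12] *)

(** Cross-multiplied, since [X + k] vanishes at [k = -4], [X = 4]. The difference of the sides has
    the factor [X Y (X + Y + 3 k) - k^3], which at [X = Y = 4] equals [(8 - k) (k + 4)^2]; [H1]
    compares with that corner. *)
Lemma linear_over_cube_decreasing k X Y :
  -4 <= k <= 8 -> 4 <= X <= Y -> Y * (X + k) ^ 3 <= X * (Y + k) ^ 3.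
Proof.
  intros Hk HXY.
  assert (HP : 16 <= X * Y) by nra.
  assert (H1 : 16 * (8 + 3 * k) <= X * Y * (X + Y + 3 * k)).
  { assert (0 <= (X + Y - 8) * (X * Y)) by nra.
    (* If [8 + 3 k < 0], a large [X Y] works against the bound; as [8 + 3 k >= -4], the term
       [X Y (X + Y - 8)] absorbs the loss. *)
    destruct (Rle_dec 0 (8 + 3 * k)); [nra|].
    assert (0 <= (X - 4) * (Y - 4)) by nra.
    nra. }
  assert (H2 : 0 <= (8 - k) * (k + 4) ^ 2)
    by (apply Rmult_le_pos; [lra | apply pow2_ge_0]).
  assert (H3 : 0 <= X * Y * (X + Y + 3 * k) - k ^ 3) by nra.
  apply Rminus_le_0.
  replace (X * (Y + k) ^ 3 - Y * (X + k) ^ 3)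
    with ((Y - X) * (X * Y * (X + Y + 3 * k) - k ^ 3)) by ring.
  apply Rmult_le_pos; lra.
Qed.

(** Since [radicand alpha r = r (X + alpha - 4)], this is the previous inequality with
    [k = alpha - 4], multiplied by [(r t)^3]. *)
Lemma radicand_cube_bound alpha r t :
  0 < alpha <= 12 -> 1 <= r <= t ->
  (t * (t + 1)) ^ 2 * radicand alpha r ^ 3
  <= (r * (r + 1)) ^ 2 * radicand alpha t ^ 3.
Proof.
  intros Ha Hrt.
  pose (X := (r + 1) ^ 2 / r).
  pose (Y := (t + 1) ^ 2 / t).
  assert (HX : 0 <= X - 4).
  { replace (X - 4) with ((r - 1) ^ 2 / r) by (unfold X; field; lra).
    apply Rdiv_le_0_compat; [apply pow2_ge_0 | lra]. }
  assert (HY : 0 <= Y - X).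
  { replace (Y - X) with ((t - r) * (r * t - 1) / (r * t))
      by (unfold X, Y; field; lra).
    apply Rdiv_le_0_compat; [|nra].
    apply Rmult_le_pos; nra. }
  assert (H := linear_over_cube_decreasing (alpha - 4) X Y ltac:(lra) ltac:(lra)).
  replace ((t * (t + 1)) ^ 2 * radicand alpha r ^ 3)
    with ((r * t) ^ 3 * (Y * (X + (alpha - 4)) ^ 3))
    by (unfold X, Y, radicand; field; lra).
  replace ((r * (r + 1)) ^ 2 * radicand alpha t ^ 3)
    with ((r * t) ^ 3 * (X * (Y + (alpha - 4)) ^ 3))
    by (unfold X, Y, radicand; field; lra).
  apply Rmult_le_compat_l; [|exact H].
  apply pow_le; nra.
Qed.

Lemma scaled_ratio'_decreasing alpha r t :
  0 < alpha <= 12 -> 1 <= r <= t -> t * ratio' alpha t <= r * ratio' alpha r.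
Proof.
  intros Ha Hrt.
  assert (Hcube := radicand_cube_bound alpha r t Ha Hrt).
  assert (HDr := radicand_pos alpha r ltac:(lra) ltac:(lra)).
  assert (HDt := radicand_pos alpha t ltac:(lra) ltac:(lra)).
  unfold ratio'.
  set (Dr := radicand alpha r) in *.
  set (Dt := radicand alpha t) in *.
  assert (HSr := sqrt_lt_R0 _ HDr).
  assert (HSt := sqrt_lt_R0 _ HDt).
  assert (HSSr := sqrt_sqrt _ (Rlt_le _ _ HDr)).
  assert (HSSt := sqrt_sqrt _ (Rlt_le _ _ HDt)).
  set (Sr := sqrt Dr) in *.
  set (St := sqrt Dt) in *.
  assert (HA : 0 < Dr * Sr) by (apply Rmult_lt_0_compat; lra).
  assert (HB : 0 < Dt * St) by (apply Rmult_lt_0_compat; lra).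
  (* The square of [Dr * Sr] is [Dr ^ 3], so this is the square root of [Hcube]. *)
  assert (Hroot : t * (t + 1) * (Dr * Sr) <= r * (r + 1) * (Dt * St)).
  { apply Rsqr_incr_0_var; [|apply Rmult_le_pos; nra].
    replace (Rsqr (t * (t + 1) * (Dr * Sr)))
      with ((t * (t + 1)) ^ 2 * (Dr ^ 2 * (Sr * Sr))) by (unfold Rsqr; ring).
    replace (Rsqr (r * (r + 1) * (Dt * St)))
      with ((r * (r + 1)) ^ 2 * (Dt ^ 2 * (St * St))) by (unfold Rsqr; ring).
    rewrite HSSr, HSSt.
    replace (Dr ^ 2 * Dr) with (Dr ^ 3) by ring.
    replace (Dt ^ 2 * Dt) with (Dt ^ 3) by ring.
    exact Hcube. }
  apply Rminus_le_0.
  replace (r * (alpha * (r + 1) / (2 * (Dr * Sr)))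
           - t * (alpha * (t + 1) / (2 * (Dt * St))))
    with (alpha * (r * (r + 1) * (Dt * St) - t * (t + 1) * (Dr * Sr))
          / (2 * ((Dr * Sr) * (Dt * St)))) by (field; lra).
  apply Rdiv_le_0_compat; [apply Rmult_le_pos; lra|].
  assert (0 < (Dr * Sr) * (Dt * St)) by (apply Rmult_lt_0_compat; assumption).
  lra.
Qed.

Lemma ratio_mul_le alpha r s :
  0 < alpha <= 12 -> 1 <= r -> 1 <= s ->
  ratio alpha (r * s) <= ratio alpha r + ratio alpha s.
Proof.
  intros Ha Hr Hs.
  (* With [s] fixed, [phi 1 = - ratio alpha s], so the claim is [phi 1 <= phi r]; [c * phi' c] is
     the drop of [u * ratio' alpha u] from [u = c] to [u = c * s]. *)
  pose (phi := fun c => ratio alpha c - ratio alpha (c * s)).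
  pose (phi' := fun c => ratio' alpha c - ratio' alpha (c * s) * s).
  assert (H : phi 1 <= phi r).
  { apply nondecreasing_of_derivative_nonneg with (f' := phi'); [lra| |].
    - intros c Hc. unfold phi, phi'.
      apply derivable_pt_lim_minus; [apply ratio_derivative; lra|].
      apply (derivable_pt_lim_comp (fun c => c * s) (ratio alpha)).
      + apply is_derive_Reals. auto_derive; [trivial | ring].
      + apply ratio_derivative; nra.
    - intros c Hc. unfold phi'.
      assert (Hd := scaled_ratio'_decreasing alpha c (c * s) Ha ltac:(nra)).
      nra. }
  unfold phi in H. rewrite Rmult_1_l in H.
  assert (ratio alpha 1 = 0) by (unfold ratio, Rdiv; ring).
  lra.
Qed.

(** * From the profile to the metric axioms *)

(** Homogeneity of degree 0: scaling by [x] takes [x ^ 2] out of the radicand. *)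
Lemma p_alpha_ratio alpha x y :
  0 < alpha -> 0 < x <= y -> p_alpha alpha x y = ratio alpha (y / x).
Proof.
  intros Ha Hxy.
  assert (H1 : 1 <= y / x) by (apply Rle_div_r; lra).
  assert (HD := radicand_pos alpha (y / x) Ha ltac:(lra)).
  assert (HS := sqrt_lt_R0 _ HD).
  unfold p_alpha, ratio.
  replace ((x - y) ^ 2 + alpha * x * y) with (x ^ 2 * radicand alpha (y / x))
    by (unfold radicand; field; lra).
  rewrite sqrt_mult by (try apply pow2_ge_0; lra).
  rewrite sqrt_pow2, Rabs_minus_sym, Rabs_pos_eq by lra.
  field; lra.
Qed.

Lemma p_alpha_sym alpha x y : p_alpha alpha x y = p_alpha alpha y x.
Proof.
  unfold p_alpha. rewrite Rabs_minus_sym. do 2 f_equal. ring.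
Qed.

Lemma p_alpha_sqrt_pos alpha x y :
  0 < alpha -> 0 < x -> 0 < y -> 0 < sqrt ((x - y) ^ 2 + alpha * x * y).
Proof.
  intros Ha Hx Hy.
  apply sqrt_lt_R0.
  assert (0 < alpha * x * y) by (repeat apply Rmult_lt_0_compat; assumption).
  assert (Hsq := pow2_ge_0 (x - y)).
  lra.
Qed.

Lemma p_alpha_nonneg alpha x y :
  0 < alpha -> 0 < x -> 0 < y -> 0 <= p_alpha alpha x y.
Proof.
  intros Ha Hx Hy.
  apply Rdiv_le_0_compat; [apply Rabs_pos | apply p_alpha_sqrt_pos; assumption].
Qed.

Lemma p_alpha_eq_0 alpha x y :
  0 < alpha -> 0 < x -> 0 < y -> p_alpha alpha x y = 0 <-> x = y.
Proof.
  intros Ha Hx Hy.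
  assert (HS := p_alpha_sqrt_pos alpha x y Ha Hx Hy).
  unfold p_alpha. split.
  - intros H.
    destruct (Req_dec (x - y) 0) as [|Hne]; [lra|].
    assert (Hpos := Rabs_pos_lt _ Hne).
    assert (Hlt := Rdiv_lt_0_compat _ _ Hpos HS).
    lra.
  - intros ->. rewrite Rminus_diag, Rabs_R0. unfold Rdiv. ring.
Qed.

(** If [z] lies outside the open interval from [x] to [y], one summand alone suffices by
    monotonicity of [ratio]; if inside, [y / x] is the product of [z / x] and [y / z]. *)
Lemma p_alpha_triangle_le alpha x y z :
  0 < alpha <= 12 -> 0 < x <= y -> 0 < z ->
  p_alpha alpha x y <= p_alpha alpha x z + p_alpha alpha z y.
Proof.
  intros Ha Hxy Hz.
  assert (Hxz := p_alpha_nonneg alpha x z ltac:(lra) ltac:(lra) Hz).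
  assert (Hzy := p_alpha_nonneg alpha z y ltac:(lra) Hz ltac:(lra)).
  assert (H1 : 1 <= y / x) by (apply Rle_div_r; lra).
  destruct (Rle_dec z x) as [Hzx|Hzx].
  - assert (p_alpha alpha x y <= p_alpha alpha z y); [|lra].
    rewrite !p_alpha_ratio by lra.
    apply ratio_nondecreasing; [lra|]. split; [assumption|].
    apply Rmult_le_compat_l; [lra|]. apply Rinv_le_contravar; lra.
  - destruct (Rle_dec y z) as [Hyz|Hyz].
    + assert (p_alpha alpha x y <= p_alpha alpha x z); [|lra].
      rewrite !p_alpha_ratio by lra.
      apply ratio_nondecreasing; [lra|]. split; [assumption|].
      apply Rmult_le_compat_r; [|lra].
      left; apply Rinv_0_lt_compat; lra.
    + rewrite !p_alpha_ratio by lra.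
      replace (y / x) with (z / x * (y / z)) by (field; lra).
      apply ratio_mul_le; [lra| |]; apply Rle_div_r; lra.
Qed.

(** * Failure of the triangle inequality for [alpha > 12] *)

(** Both sides share the factor [r - 1]; cancelling it and squaring leaves a polynomial inequality
    whose difference is [(r - 1)^2] times the gap in the last hypothesis. *)
Lemma ratio_square_gt_double alpha r :
  0 < alpha -> 1 < r -> 3 * (r + 1) ^ 2 < alpha * r ->
  2 * ratio alpha r < ratio alpha (r * r).
Proof.
  intros Ha Hr Hgap.
  assert (HD1 := radicand_pos alpha r Ha ltac:(lra)).
  assert (HD2 := radicand_pos alpha (r * r) Ha ltac:(nra)).
  assert (HS1 := sqrt_lt_R0 _ HD1).
  assert (HS2 := sqrt_lt_R0 _ HD2).
  assert (HSS1 := sqrt_sqrt _ (Rlt_le _ _ HD1)).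
  assert (HSS2 := sqrt_sqrt _ (Rlt_le _ _ HD2)).
  unfold ratio.
  set (S1 := sqrt (radicand alpha r)) in *.
  set (S2 := sqrt (radicand alpha (r * r))) in *.
  assert (Hroot : 2 * S2 < (r + 1) * S1).
  { apply Rsqr_incrst_0; [|lra|nra].
    replace (Rsqr (2 * S2)) with (4 * (S2 * S2)) by (unfold Rsqr; ring).
    replace (Rsqr ((r + 1) * S1)) with ((r + 1) ^ 2 * (S1 * S1))
      by (unfold Rsqr; ring).
    rewrite HSS1, HSS2.
    apply Rminus_lt_0. unfold radicand.
    replace ((r + 1) ^ 2 * ((r - 1) ^ 2 + alpha * r)
             - 4 * ((r * r - 1) ^ 2 + alpha * (r * r)))
      with ((r - 1) ^ 2 * (alpha * r - 3 * (r + 1) ^ 2)) by ring.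
    apply Rmult_lt_0_compat; [apply pow_lt|]; lra. }
  apply Rminus_lt_0.
  replace ((r * r - 1) / S2 - 2 * ((r - 1) / S1))
    with ((r - 1) * ((r + 1) * S1 - 2 * S2) / (S1 * S2)) by (field; lra).
  apply Rdiv_lt_0_compat; apply Rmult_lt_0_compat; lra.
Qed.

Lemma triangle_alpha_le alpha :
  0 < alpha ->
  (forall x y z, 0 < x -> 0 < y -> 0 < z ->
     p_alpha alpha x y <= p_alpha alpha x z + p_alpha alpha z y) ->
  alpha <= 12.
Proof.
  intros Ha Htri.
  apply Rnot_lt_le. intros Hgt.
  (* For [r = 1 + d], [alpha r - 3 (r + 1)^2 = (alpha - 12) (1 + d) - 3 d^2], which is at least
     [3 d] once [alpha - 12 >= 3 d]. *)
  pose (d := Rmin 1 (alpha / 3 - 4)).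
  assert (Hd0 : 0 < d) by (apply Rmin_glb_lt; lra).
  assert (Hd1 : d <= 1) by apply Rmin_l.
  assert (Hd2 : d <= alpha / 3 - 4) by apply Rmin_r.
  pose (r := 1 + d).
  assert (Hr : 1 < r) by (unfold r; lra).
  assert (Hgap : 3 * (r + 1) ^ 2 < alpha * r) by (unfold r; nra).
  assert (Hdouble := ratio_square_gt_double alpha r Ha Hr Hgap).
  specialize (Htri 1 (r * r) r ltac:(lra) ltac:(nra) ltac:(lra)).
  rewrite !p_alpha_ratio in Htri by nra.
  replace (r * r / r) with r in Htri by (field; lra).
  rewrite !Rdiv_1_r in Htri.
  lra.
Qed.

Theorem theorem5p2 (alpha : R) (halpha : 0 < alpha) :
  is_metric_on Rpos (p_alpha alpha) <-> alpha <= 12.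
Proof.
  split.
  - intros (_ & _ & _ & Htri).
    exact (triangle_alpha_le alpha halpha Htri).
  - intros Hle. unfold is_metric_on, Rpos.
    split; [|split; [|split]].
    + intros; apply p_alpha_nonneg; assumption.
    + intros; apply p_alpha_eq_0; assumption.
    + intros; apply p_alpha_sym.
    + intros x y z Hx Hy Hz.
      destruct (Rle_dec x y).
      * apply p_alpha_triangle_le; lra.
      * rewrite (p_alpha_sym alpha x y), (p_alpha_sym alpha x z),
          (p_alpha_sym alpha z y), Rplus_comm.
        apply p_alpha_triangle_le; lra.
Qed.
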